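(* Let $X\subset\mathcal{A}^{\mathbb{Z}}$ be a subshift over a finite alphabet $\mathcal{A}$ with a unique measure of maximal entropy $\mu$. Suppose that: (1) there exists a constant $C$ so that $|\mathcal{L}_n(X)| < Ce^{nh(X)}$ for all $n$; (2) there exist $G' \subset \mathcal{L}(X)$ and an integer $R\ge 0$ so that for all $u,v,w \in G'$, there exist $y,z \in \mathcal{A}^R$ for which $uyvzw \in \mathcal{L}(X)$; and (3) there exist $\epsilon > 0$ and a syndetic set $S\subseteq\mathbb{N}$ so that $\mu(G'_n) > \epsilon$ for every $n \in S$. Then there exists a constant $D>0$ so that for all $w \in G'$, \[ \mu([w]) \geq De^{-|w|h(X)}. \]
   Context: A subshift is a (nonempty) closed subset $X$ of $\mathcal{A}^{\mathbb{Z}}$ ($\mathcal{A}$ finite, product topology) invariant under the shift $(\sigma x)_n=x_{n+1}$. $\mathcal{L}(X)$ is the set of all finite words appearing in points of $X$, and $\mathcal{L}_n(X)$ is the set of those of length $n$. $|w|$ is the length of the word $w$; $\mathcal{A}^R$ is the set of words of length $R$; juxtaposition of words denotes concatenation. The topological entropy is $h(X)=\lim_{n\to\infty}\frac1n\log|\mathcal{L}_n(X)|$ (natural logarithm). For a set $G'$ of words, $G'_n$ is the set of words in $G'$ of length $n$. For $w\in\mathcal{L}_n(X)$, $[w]=\{x\in X: x_1\ldots x_n=w\}$, and for a measure $\mu$ on $X$, $\mu(G'_n):=\mu\left(\bigcup_{w\in G'_n}[w]\right)$. A measure of maximal entropy (MME) on $X$ is a $\sigma$-invariant Borel probability measure $\mu$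 supported on $X$ with measure-theoretic entropy $h(\mu)=\lim_n -\frac1n\sum_{w\in\mathcal{A}^n}\mu([w])\log\mu([w])$ equal to $h(X)$. A set $S\subseteq\mathbb{N}$ is syndetic if there exists $N$ so that $\{k,\ldots,k+N-1\}\cap S\neq\varnothing$ for every $k$. *)

(* Defs.v *)
From HB Require Import structures.
From mathcomp Require Import all_boot all_order all_algebra.
From mathcomp Require Import all_classical all_reals all_analysis.

Set Implicit Arguments.
Unset Strict Implicit.
Unset Printing Implicit Defensive.

Import Order.TTheory GRing.Theory Num.Theory.
Import numFieldNormedType.Exports.

Local Open Scope classical_set_scope.
Local Open Scope ring_scope.

(* MathComp-Analysis requires measurable types to be pointed; the letter [a0]
   serves only to exhibit a point of A^Z, the constant sequence [a0].  It exists
   as soon as A carries a (nonempty) subshift. *)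
Definition fullshift (A : finType) (a0 : A) : Type :=
  prod_topology (fun _ : int => discrete_topology A).

HB.instance Definition _ (A : finType) (a0 : A) :=
  Topological.copy (fullshift a0)
    (prod_topology (fun _ : int => discrete_topology A)).
HB.instance Definition _ (A : finType) (a0 : A) :=
  isPointed.Build (fullshift a0) (fun=> a0).

Definition borel_fullshift (A : finType) (a0 : A) :=
  g_sigma_algebraType (@open (fullshift a0)).

Section Subshift.
Context (A : finType) (a0 : A).
Implicit Types (X : set (fullshift a0)) (x : fullshift a0).

Definition shift x : fullshift a0 := fun n : int => x (n + 1).

Definition is_subshift X : Prop :=
  [/\ X !=set0, closed X & shift @` X = X].

(* the word x_i x_{i+1} ... x_{i+n-1} *)
Definition factor x (i : int) (n : nat) : seq A :=
  mkseq (fun k : nat => x (i + k%:Z)) n.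

Definition language X : set (seq A) :=
  [set w | exists2 x, X x & exists i : int, factor x i (size w) = w].

Definition complexity X (n : nat) : nat :=
  #|[pred w : n.-tuple A | `[< language X w >]]|.

Definition cylinder X (w : seq A) : set (fullshift a0) :=
  [set x | X x /\ factor x 1 (size w) = w].

Definition words_of_length (G : set (seq A)) (n : nat) : set (seq A) :=
  [set w | G w /\ size w = n].

Definition cylinder_union X (G : set (seq A)) : set (fullshift a0) :=
  \bigcup_(w in G) cylinder X w.

End Subshift.

Section Entropy.
Context (R : realType) (A : finType) (a0 : A).
Implicit Types (X : set (fullshift a0)) (mu : probability (borel_fullshift a0) R).

Definition topological_entropy X : R :=
  lim ((fun n : nat => ln (complexity X n)%:R / n%:R : R) @ \oo).

Definition shift_invariant mu : Prop :=
  forall B : set (borel_fullshift a0), measurable B ->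
    mu (@shift A a0 @^-1` B) = mu B.

(* [ln 0 = 0] in the library, so null cylinders contribute 0. *)
Definition measure_entropy X mu : R :=
  lim ((fun n : nat => - (\sum_(w : n.-tuple A)
    fine (mu (cylinder X w)) * ln (fine (mu (cylinder X w)))) / n%:R : R) @ \oo).

(* For a closed set X, being supported on X amounts to [mu X = 1]. *)
Definition is_MME X mu : Prop :=
  [/\ shift_invariant mu, mu X = 1%E
    & measure_entropy X mu = topological_entropy X].

(* Measures of the library are functions on all sets, whose values matter only
   on measurable ones, hence uniqueness up to equality on Borel sets. *)
Definition is_unique_MME X mu : Prop :=
  is_MME X mu /\
  forall nu : probability (borel_fullshift a0) R, is_MME X nu ->
    forall B : set (borel_fullshift a0), measurable B -> nu B = mu B.

End Entropy.

Arguments topological_entropy R {A a0} X.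

Definition syndetic (S : set nat) : Prop :=
  exists N : nat, forall k : nat, exists2 n : nat, (k <= n < k + N)%N & S n.

(* Main.v *)
From HB Require Import structures.
From mathcomp Require Import all_boot all_order all_algebra.
From mathcomp Require Import all_classical all_reals all_analysis.
From mathcomp Require Import finmap zify ring lra.
Require Import Defs.

Set Implicit Arguments.
Unset Strict Implicit.
Unset Printing Implicit Defensive.

Import Order.TTheory GRing.Theory Num.Theory.
Import numFieldNormedType.Exports.

Local Open Scope classical_set_scope.
Local Open Scope ring_scope.

(** Write h for the entropy of X, L_N for the words of length N of X and c_N
    for their number; by Fekete's lemma c_N is at least e^(N h).

    The measure mu is reached by counting.  Choose a point of X through each
    word of L_N and average, over these points and over their first N
    translates, the Dirac masses.  The resulting empirical measures give to
    [w] the mean number of occurrences of w in a word of L_N, divided by N, up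
    to the occurrences that overlap the end.
    Their limit along an ultrafilter is a finitely additive, shift-invariant
    function of sets; on clopen sets it is countably additive by compactness,
    so it extends to an invariant Borel probability nu ([invariant_extension]).

    The limit nu maximizes entropy.  Cut a word of L_N into blocks of length n,
    starting at each of the n offsets, and compare the uniform law on L_N with
    the product of the empirical laws of the blocks: Gibbs' inequality bounds
    ln c_N by N/n times the entropy of the empirical law on n-blocks, up to
    boundary terms ([ln_complexity_le_block_entropy]).  In the limit the n-block
    entropy of nu is at least n h, and it is at most ln c_n since nu lives on X.
    Uniqueness then gives nu = mu ([frequency_limit_MME]).

    It remains to bound the number of occurrences of a word w of G from below.
    Since the n-block entropy of mu is at least n h while c_n is at most
    C e^(n h), a set of n-words of measure greater than eps has at least
    kappa e^(n h) elements, with kappa depending on C and eps only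
    ([card_large_set]).  Gluing gives words u y w z v for all u and v in G of
    lengths i and j; syndeticity leaves a choice of i in every window of bounded
    length, and for each i a choice of j for which the glued word almost fills
    N letters.  Hence each of a positive proportion of positions carries w in at
    least a constant times e^((N - |w|) h) of the at most C e^(N h) words of
    L_N ([word_frequency_lower_bound]).  Dividing and letting N tend to infinity
    gives mu [w] >= D e^(-|w| h). *)

(** * Measures from finitely additive functions on clopen sets *)

(** An alias of the space that carries the algebra of clopen sets in place of
    any other measurable structure. *)
Definition clopen_sets (T : Type) : Type := T.

Section ClopenAlgebra.
Variable T : ptopologicalType.

HB.instance Definition _ := Pointed.on (clopen_sets T).
HB.instance Definition _ := isAlgebraOfSets.Build default_measure_display
  (clopen_sets T) (@clopen0 T) (@clopenU T) (fun A cA => clopenC A cA).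

Variables (R : realType) (m : set T -> R).
Hypothesis compactT : compact [set: T].
Hypothesis m_ge0 : forall A, clopen A -> 0 <= m A.
Hypothesis mU : forall A B, clopen A -> clopen B -> A `&` B = set0 ->
  m (A `|` B) = m A + m B.

(** A content has to be nonnegative on all sets, while m is so on
    clopen sets: hence the value 0 elsewhere. *)
Definition clopen_content : set (clopen_sets T) -> \bar R :=
  fun A => if pselect (clopen (A : set T)) is left _ then (m A)%:E else 0%E.

Lemma clopen_contentE (A : set T) : clopen A -> clopen_content A = (m A)%:E.
Proof. by rewrite /clopen_content; case: pselect. Qed.

Let content_ge0 A : (0 <= clopen_content A)%E.
Proof.
by rewrite /clopen_content; case: pselect => // cA; rewrite lee_fin m_ge0.
Qed.

Let content0 : clopen_content set0 = 0%E.
Proof.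
have c0 := @clopen0 T; rewrite clopen_contentE//; congr _%:E.
have := mU c0 c0 (setI0 _); rewrite setU0 => /eqP.
by rewrite -subr_eq0 opprD addrA subrr add0r oppr_eq0 => /eqP.
Qed.

Let content_semi_additive : measure_function.semi_additive clopen_content.
Proof.
apply/(additive2P content0) => A B cA cB AB.
rewrite clopen_contentE; last exact: clopenU.
by rewrite !clopen_contentE// mU.
Qed.

HB.instance Definition _ := isContent.Build default_measure_display
  (clopen_sets T) R clopen_content content_ge0 content_semi_additive.

(** A countable clopen cover of a clopen set, which is compact, has a finite
    subcover: countable subadditivity reduces to finite subadditivity. *)
Let content_sigma_subadditive :
  measurable_subset_sigma_subadditive clopen_content.
Proof.
move=> A F cF cA AF.
have : cover_compact A.
  rewrite -compact_cover; apply: (subclosed_compact _ compactT) => //.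
  by case: cA.
move=> /(_ nat setT F)[i _|//|D _ AD]; first by case: (cF i).
pose n := (\max_(i <- D) i).+1.
have sub : A `<=` \big[setU/set0]_(k < n) F k.
  move=> x /AD[i /= iD Fix]; rewrite -bigcup_mkord; exists i => //=.
  by rewrite /n ltnS; apply: leq_bigmax_seq.
apply: (@le_trans _ _ (\sum_(k < n) clopen_content (F k))%E).
  exact: (@content_subadditive _ _ (clopen_sets T) clopen_content).
rewrite -(big_mkord xpredT (clopen_content \o F)).
by apply: nneseries_lim_ge.
Qed.

HB.instance Definition _ := Content_SigmaSubAdditive_isMeasure.Build
  default_measure_display R (clopen_sets T) clopen_content
  content_sigma_subadditive.

Hypothesis base_clopen : forall U : set T, open U ->
  exists2 F : nat -> set T, (forall n, clopen (F n)) & U = \bigcup_n F n.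

Lemma open_sigma_clopen :
  <<s @open T >> =
  <<s (default_measure_display.-measurable : set (set (clopen_sets T))) >>.
Proof.
apply/seteqP; split; last by apply: sub_sigma_algebra2 => A [].
apply: smallest_sub; first exact: smallest_sigma_algebra.
move=> U /base_clopen[F cF ->].
apply: sigma_algebra_bigcup => n.
by apply: sub_sigma_algebra; exact: cF.
Qed.

(** The extension of the content lives on the sigma-algebra generated by the
    algebra of clopen sets; [open_sigma_clopen] identifies it with the Borel
    one. *)
Definition borel_extension : set (g_sigma_algebraType (@open T)) -> \bar R :=
  measure_extension clopen_content.

Let borel0 : borel_extension set0 = 0%E.
Proof. exact: measure0. Qed.

Let borel_ge0 A : (0 <= borel_extension A)%E.
Proof. exact: measure_ge0. Qed.

Let borel_sigma_additive : semi_sigma_additive borel_extension.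
Proof.
move=> F mF tF mUF.
apply: (@measure_semi_sigma_additive _ _ _ (measure_extension clopen_content))
  => //.
  by move=> i; have := mF i; rewrite /measurable/= open_sigma_clopen.
by move: mUF; rewrite /measurable/= open_sigma_clopen.
Qed.

Hypothesis mT : m setT = 1.

Lemma clopen_extension :
  exists nu : probability (g_sigma_algebraType (@open T)) R,
  forall A : set T, clopen A -> nu A = (m A)%:E.
Proof.
pose mM := isMeasure.Build _ _ R borel_extension borel0 borel_ge0
  borel_sigma_additive.
pose M : {measure set _ -> \bar R} := HB.pack borel_extension mM.
have ME A : clopen A -> M A = (m A)%:E.
  by move=> cA; rewrite /M/= /borel_extension /measure_extension
    measurable_mu_extE//= clopen_contentE.
have M1 : M setT = 1%E by rewrite ME ?mT//; exact: clopenT.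
pose mP := Measure_isProbability.Build _ _ R M M1.
pose P : probability (g_sigma_algebraType (@open T)) R :=
  HB.pack borel_extension mM mP.
by exists P.
Qed.

End ClopenAlgebra.

(** * Clopen subsets of the full shift *)

Section FullShiftTopology.
Context (A : finType) (a0 : A).
Implicit Types (x y : fullshift a0) (U : set (fullshift a0)).

Lemma fullshift_compact : compact [set: fullshift a0].
Proof.
have finA (i : int) : @compact (discrete_topology A) setT.
  by apply: finite_compact; exact: finite_finset.
have := @tychonoff int (fun=> discrete_topology A) (fun=> setT) finA.
by rewrite (_ : mkset _ = [set: fullshift a0])//; apply/seteqP.
Qed.

Lemma coordinate_clopen (i : int) (B : set A) :
  clopen [set x : fullshift a0 | B (x i)].
Proof.
apply: (@preimage_clopen _ (discrete_topology A)
  (fun x : fullshift a0 => x i) B).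
  by split; [exact: discrete_open | exact: discrete_closed].
exact: (@proj_continuous _ (fun=> discrete_topology A)).
Qed.

(** Both the set and its complement contain, with each point, the open set of
    the points with the same finitely many coordinates. *)
Lemma finite_coordinates_clopen (s : seq int) U :
  (forall x y, {in s, forall i, x i = y i} -> U x -> U y) -> clopen U.
Proof.
have agree_open x : open [set y : fullshift a0 | {in s, forall i, x i = y i}].
  elim: s {U} => [|i s IH].
    have -> : [set y : fullshift a0 | {in [::], forall i, x i = y i}] = setT.
      by apply/seteqP; split.
    exact: openT.
  have -> : [set y : fullshift a0 | {in i :: s, forall j, x j = y j}] =
      [set y | [set x i] (y i)] `&` [set y | {in s, forall j, x j = y j}].
    apply/seteqP; split => [y xy|y [/= xyi xys] j].
      split=> [|j js]; first by rewrite /= xy ?mem_head.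
      by apply: xy; rewrite inE js orbT.
    by rewrite inE => /orP[/eqP->//|]; exact: xys.
  by apply: openI IH; have [] := coordinate_clopen i [set x i].
have det_open V : (forall x y, {in s, forall i, x i = y i} -> V x -> V y) ->
  open V.
  move=> detV; rewrite openE => x Vx; rewrite /interior.
  apply: (@filterS _ _ _ [set y | {in s, forall i, x i = y i}]).
    by move=> y xy; exact: detV Vx.
  by apply: open_nbhs_nbhs; split.
move=> detU; split; first exact: det_open.
rewrite -openC; apply: det_open => x y xy nUx Uy; apply: nUx.
by apply: detU Uy => i si; rewrite xy.
Qed.

Definition window (k : nat) x : set (fullshift a0) :=
  [set y | forall i : int, (`|i| <= k)%N -> x i = y i].

Lemma window_determined_clopen k U :
  (forall x y, window k x y -> U x -> U y) -> clopen U.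
Proof.
move=> detU.
pose s := [seq Posz i | i <- iota 0 k.+1] ++ [seq - Posz i | i <- iota 0 k.+1].
apply: (@finite_coordinates_clopen s) => x y xy; apply: detU => i ik.
apply: xy; rewrite mem_cat; apply/orP.
case: i ik => i ik; [left|right]; apply/mapP.
  by exists i; rewrite ?mem_iota//; lia.
by exists i.+1; rewrite ?mem_iota; lia.
Qed.

(** The windows around x form a base of neighbourhoods, because the filter that
    they generate converges to x coordinatewise. *)
Lemma open_window U x : open U -> U x -> exists k, window k x `<=` U.
Proof.
move=> oU Ux.
pose F := filter_from [set: nat] (window ^~ x).
have FF : Filter F.
  apply: filter_from_filter; first by exists 0%N.
  move=> i j _ _; exists (maxn i j) => // y xy.
  by split=> l ll; apply: xy; rewrite leq_max ll ?orbT.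
have Fx : F --> x.
  apply/cvg_sup => i V [W] [[/= B oB <-]] Bx BV.
  exists `|i|%N => // y xy; apply: BV => /=; rewrite -xy//.
have [k _ kU] : F U by apply: Fx; exact: open_nbhs_nbhs.
by exists k.
Qed.

(** The n-th piece consists of the points whose n-th window is inside the open
    set; this is a union of windows, hence determined by finitely many
    coordinates. *)
Lemma open_bigcup_clopen U : open U ->
  exists2 F : nat -> set (fullshift a0), (forall n, clopen (F n)) &
    U = \bigcup_n F n.
Proof.
move=> oU; exists (fun k => [set x | window k x `<=` U]).
  move=> k; apply: (@window_determined_clopen k) => x y xy + z yz.
  by apply => i ik; rewrite xy// yz.
apply/seteqP; split=> [x Ux|x [k _]]; last exact.
by have [k kU] := open_window oU Ux; exists k.
Qed.

Lemma shift_clopen U : clopen U -> clopen (@shift A a0 @^-1` U).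
Proof.
suff shift_open V : open V -> open (@shift A a0 @^-1` V).
  by move=> [oU cU]; split; [exact: shift_open | rewrite -openC;
    apply: (shift_open (~` U)); rewrite openC].
move=> oV; rewrite openE => x /(open_window oV)[k kV]; rewrite /interior.
apply: (@filterS _ _ _ (window k.+1 x)).
  by move=> y xy; apply: kV => i ik; rewrite /shift xy//; lia.
apply: open_nbhs_nbhs; split => //.
apply: (proj1 (@window_determined_clopen k.+1 _ _)) => y z yz xy i ik.
by rewrite xy// yz.
Qed.

Lemma factor_clopen (w : seq A) :
  clopen [set x : fullshift a0 | factor x 1 (size w) = w].
Proof.
apply: (@finite_coordinates_clopen [seq Posz i.+1 | i <- iota 0 (size w)]).
move=> x y xy /= xw; rewrite -[RHS]xw; apply/eq_in_map => k.
rewrite mem_iota => /andP[_ kw]; rewrite xy//.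
by rewrite -intS; apply/mapP; exists k => //; rewrite mem_iota.
Qed.

End FullShiftTopology.

(** * Invariant Borel probabilities on the full shift *)

Section InvariantExtension.
Context (R : realType) (A : finType) (a0 : A).

Lemma measurable_clopen (U : set (fullshift a0)) : clopen U ->
  measurable (U : set (borel_fullshift a0)).
Proof. by case=> oU _; exact: sub_sigma_algebra. Qed.

Lemma measurable_closed (X : set (fullshift a0)) : closed X ->
  measurable (X : set (borel_fullshift a0)).
Proof.
move=> cX; rewrite -[X]setCK; apply: measurableC; apply: sub_sigma_algebra.
by rewrite /= openC.
Qed.

Lemma measurable_shift :
  measurable_fun [set: borel_fullshift a0]
    (@shift A a0 : borel_fullshift a0 -> borel_fullshift a0).
Proof.
apply: (@measurability _ _ (borel_fullshift a0) (borel_fullshift a0) setT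
  (@shift A a0) (@open (fullshift a0))) => //.
move=> _ [U oU <-]; rewrite setTI.
have [F cF ->] := open_bigcup_clopen oU; rewrite preimage_bigcup.
apply: bigcupT_measurable => n; apply: measurable_clopen.
exact: shift_clopen.
Qed.

(** Invariance passes from clopen sets to Borel sets because the image of the
    extension under the shift is a probability that agrees with it on an
    intersection-stable generating family. *)
Lemma invariant_extension (m : set (fullshift a0) -> R) :
  (forall U, clopen U -> 0 <= m U) ->
  (forall U V, clopen U -> clopen V -> U `&` V = set0 ->
    m (U `|` V) = m U + m V) ->
  m setT = 1 ->
  (forall U, clopen U -> m (@shift A a0 @^-1` U) = m U) ->
  exists nu : probability (borel_fullshift a0) R, shift_invariant nu /\
    forall U : set (fullshift a0), clopen U -> nu U = (m U)%:E.
Proof.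
move=> m_ge0 mU mT minv.
have [nu nuE] := clopen_extension (@fullshift_compact A a0) m_ge0 mU
  (@open_bigcup_clopen A a0) mT.
exists nu; split=> // B mB.
pose mf := isMeasurableFun.Build _ _ _ _ _ measurable_shift.
pose f : {mfun borel_fullshift a0 >-> borel_fullshift a0} :=
  HB.pack (@shift A a0 : borel_fullshift a0 -> borel_fullshift a0) mf.
change (distribution nu f B = nu B).
apply: (@g_sigma_algebra_measure_unique _ R (borel_fullshift a0)
  (@clopen (fullshift a0)) _ (fun=> setT)) => //.
- by move=> U cU; exact: measurable_clopen.
- by move=> _; exact: clopenT.
- by rewrite bigcup_const//; exists 0%N.
- exact: clopenI.
- move=> U cU; have := nuE _ (shift_clopen cU); rewrite minv// => nuU.
  exact: etrans nuU (esym (nuE _ cU)).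
- have nuT : (nu setT < +oo)%E by rewrite probability_setT ltry.
  by move=> _; exact: nuT.
- by move: mB; rewrite /measurable/= (open_sigma_clopen (@open_bigcup_clopen A
  a0)).
Qed.

Lemma null_complement_closed (X : set (fullshift a0))
    (nu : probability (borel_fullshift a0) R) :
  closed X ->
  (forall U : set (fullshift a0), clopen U -> U `&` X = set0 -> nu U = 0%E) ->
  nu X = 1%E.
Proof.
move=> cX nullU.
have mX := measurable_closed cX.
have mXC : measurable (~` X : set (borel_fullshift a0)) by exact: measurableC.
suff nuXC : nu (~` X) = 0%E.
  rewrite -(probability_setT nu) -(setUv X) (measureU nu mX mXC (setICr X)).
  exact: esym (etrans (congr1 (adde (nu X)) nuXC) (adde0 _)).
have [F cF FX] : exists2 F : nat -> set (fullshift a0),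
    (forall n, clopen (F n)) & ~` X = \bigcup_n F n.
  by apply: open_bigcup_clopen; rewrite openC.
have mF n : measurable (F n : set (borel_fullshift a0)).
  exact: measurable_clopen.
rewrite FX; apply: le_anti; apply/andP; split; last exact: measure_ge0.
apply: (@le_trans _ _ (\sum_(n <oo) nu (F n))%E).
  apply: measure_sigma_subadditive => //.
  by apply: bigcupT_measurable.
rewrite eseries0// => n _ _; apply: nullU => //.
by apply/seteqP; split=> // x [Fx Xx]; have : (~` X) x by rewrite FX; exists n.
Qed.
End InvariantExtension.

(** * Finite probability vectors and subadditive sequences *)

Section FiniteEntropy.
Variable R : realType.

Lemma ln_prod (I : Type) (r : seq I) (F : I -> R) : (forall i, 0 < F i) ->
  ln (\prod_(i <- r) F i) = \sum_(i <- r) ln (F i).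
Proof.
move=> F0; elim: r => [|i r IH]; first by rewrite !big_nil ln1.
by rewrite !big_cons lnM ?posrE ?prodr_gt0// IH.
Qed.

(** This is ln (q/p) <= q/p - 1 multiplied by p.  Keeping the terms p and q on
    both sides makes it hold at p = 0 as well, where it also bounds - p ln p
    by a function linear in p. *)
Lemma gibbs_term (p q : R) : 0 <= p -> 0 <= q -> (0 < p -> 0 < q) ->
  p * ln q + p <= p * ln p + q.
Proof.
rewrite le_eqVlt => /predU1P[<- q0 _|p0 q0 /(_ p0) {}q0].
  by rewrite !mul0r !addr0 add0r.
have qp0 : 0 < q / p by rewrite divr_gt0.
have := @le_ln1Dx R (q / p - 1);
  rewrite addrCA subrr addr0 ltrBrDl subrr => /(_ qp0).
rewrite ln_div ?posrE// -(ler_pM2l p0) !mulrBr mulr1 mulrCA divff ?gt_eqF//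
  mulr1.
lra.
Qed.

(** Gibbs' inequality: the entropy of p is at most its cross entropy against a
    subprobability q. *)
Lemma gibbs (I : finType) (p q : I -> R) :
  (forall i, 0 <= p i) -> (forall i, 0 <= q i) ->
  (forall i, 0 < p i -> 0 < q i) ->
  \sum_i q i <= \sum_i p i -> \sum_i p i * ln (q i) <= \sum_i p i * ln (p i).
Proof.
move=> p0 q0 pq qp.
have : \sum_i (p i * ln (q i) + p i) <= \sum_i (p i * ln (p i) + q i).
  by apply: ler_sum => i _; apply: gibbs_term => //; exact: pq.
rewrite !big_split/=; lra.
Qed.

Lemma subadditive_mul_add (a : nat -> R) (k s q : nat) :
  (forall m n, a (m + n)%N <= a m + a n) -> a (q * k + s)%N <= q%:R * a k + a s.
Proof.
move=> asub; elim: q => [|q IH]; first by rewrite mul0n add0n mul0r add0r.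
rewrite mulSn -addnA (le_trans (asub _ _))// (le_trans (lerD (lexx _) IH))//.
by rewrite -natr1; lra.
Qed.

(** Division of n by k compares a n / n with a k / k up to O(1/n), so the
    quotients converge to their infimum. *)
Lemma fekete (a : nat -> R) :
  (forall n, 0 <= a n) -> (forall m n, a (m + n)%N <= a m + a n) ->
  cvgn (fun n => a n / n%:R) /\
  forall n, n%:R * limn (fun n => a n / n%:R) <= a n.
Proof.
move=> a0 asub.
pose E := [set a n / n%:R | n in [set n | (0 < n)%N]].
have E0 x : E x -> 0 <= x by move=> [n _ <-]; rewrite divr_ge0.
have infE : has_inf E.
  by split; [exists (a 1%N / 1%:R); exists 1%N | exists 0 => x /E0].
have le_inf n : (0 < n)%N -> inf E <= a n / n%:R.
  by move=> n0; apply: ge_inf; [exact: infE.2|exists n].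
suff aE : (fun n => a n / n%:R) @ \oo --> inf E.
  split; first by apply/cvg_ex; exists (inf E).
  move=> [|n]; first by rewrite mul0r.
  by rewrite (cvg_lim _ aE)// mulrC -ler_pdivlMr ?ltr0n// le_inf.
apply/cvgrPdist_lt => e e0.
have [_ [k /= k0 <-] ak] : exists2 x, E x & x < inf E + e / 2.
  by apply: inf_adherent => //; rewrite divr_gt0.
pose B := k%:R * a 1%N + a 0%N.
have B0 : 0 <= B by rewrite addr_ge0 ?mulr_ge0.
near=> n.
have n0 : (0 < n)%N by near: n; exact: nbhs_infty_gt.
have nR : 0 < n%:R :> R by rewrite ltr0n.
rewrite ler0_norm ?subr_le0 ?le_inf// opprB ltrBlDl.
have an : a n <= (n %/ k)%:R * a k + B.
  rewrite {1}(divn_eq n k) (le_trans (subadditive_mul_add _ _ _ asub))//.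
  rewrite lerD2l -[X in a X]addn0 -[X in (X + 0)%N]muln1.
  rewrite (le_trans (subadditive_mul_add _ _ _ asub))// lerD2r ler_wpM2r//.
  by rewrite ler_nat ltnW// ltn_mod.
have akn : (n %/ k)%:R * a k <= n%:R * (a k / k%:R).
  rewrite [leRHS]mulrCA [leLHS]mulrC ler_wpM2l//.
  by rewrite ler_pdivlMr ?ltr0n// -natrM ler_nat leq_trunc_div.
have Bn : B / n%:R < e / 2.
  rewrite ltr_pdivrMr// mulrC -ltr_pdivrMr ?divr_gt0//.
  by near: n; exact: nbhs_infty_gtr.
have : a n / n%:R <= a k / k%:R + B / n%:R.
  rewrite ler_pdivrMr// mulrDl divfK ?gt_eqF// (le_trans an)// lerD2r.
  by rewrite (le_trans akn)// mulrC.
lra.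
Unshelve. all: by end_near. Qed.

End FiniteEntropy.

(** * Words of a subshift *)

Lemma cat_tuple_bij (T : finType) m n :
  bijective (fun p : m.-tuple T * n.-tuple T => [tuple of p.1 ++ p.2]).
Proof.
apply: inj_card_bij; last by rewrite card_prod !card_tuple expnD.
move=> [u v] [u' v'] /(congr1 val) /= /eqP.
rewrite eqseq_cat ?size_tuple// => /andP[/eqP uu' /eqP vv'].
by congr (_, _); apply: val_inj.
Qed.

Definition word_in (A : finType) (G : set (seq A)) n : pred (n.-tuple A) :=
  fun w => `[< G w >].

Section Words.
Context (A : finType) (a0 : A) (X : set (fullshift a0)).
Hypothesis subX : is_subshift X.
Implicit Types (x y : fullshift a0) (u v w : seq A).

Lemma size_factor x i n : size (factor x i n) = n.
Proof. by rewrite size_mkseq. Qed.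

Lemma factor_cat x i m n :
  factor x i (m + n) = factor x i m ++ factor x (i + m%:Z) n.
Proof.
rewrite /factor /mkseq iotaD map_cat add0n; congr (_ ++ _).
rewrite -[in LHS](addn0 m) iotaDl -map_comp; apply: eq_map => k /=.
by rewrite PoszD addrA.
Qed.

Lemma iter_shiftE t x (n : int) : iter t (@shift A a0) x n = x (n + t%:Z).
Proof.
elim: t n => [|t IH] n; first by rewrite addr0.
by rewrite iterS /shift IH -addn1 PoszD [in RHS](addrC t%:Z) addrA.
Qed.

Lemma factor_iter_shift t x i n :
  factor (iter t (@shift A a0) x) i n = factor x (i + t%:Z) n.
Proof. by apply: eq_mkseq => k; rewrite iter_shiftE addrAC. Qed.

Lemma subshift_iter t x : X x -> X (iter t (@shift A a0) x).
Proof.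
case: subX => _ _ XE Xx; elim: t => //= t IH.
by rewrite -XE; exists (iter t (@shift A a0) x).
Qed.

Lemma subshift_translate (k : int) x : X x -> X (fun n => x (n + k)).
Proof.
case: k => t Xx.
  have := subshift_iter t Xx; congr X; apply/funext => n; exact: iter_shiftE.
have [y Xy yx] : exists2 y, X y & iter t.+1 (@shift A a0) y = x.
  elim: t.+1 => [|s [y Xy yx]]; first by exists x.
  have [_ _ XE] := subX; move: (Xy); rewrite -{1}XE => -[z Xz zy].
  by exists z => //; rewrite iterSr zy.
move: Xy; congr X; apply/funext => n.
by rewrite -yx iter_shiftE NegzE subrK.
Qed.

(** Invariance of X under both directions of the shift lets a word of the
    language be read at coordinate 1. *)
Lemma languageP w :
  language X w <-> exists2 x, X x & factor x 1 (size w) = w.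
Proof.
split=> [[x Xx [i xw]]|[x Xx xw]]; last by exists x => //; exists 1.
exists (fun n => x (n + (i - 1))); first exact: subshift_translate.
rewrite -[RHS]xw; apply: eq_mkseq => k; congr x; lia.
Qed.

Lemma language_factor x i n : X x -> language X (factor x i n).
Proof. by move=> Xx; exists x => //; exists i; rewrite size_factor. Qed.

Lemma language_catl u v : language X (u ++ v) -> language X u.
Proof.
move=> /languageP[x Xx]; rewrite size_cat factor_cat.
by move=> /eqP; rewrite eqseq_cat ?size_factor// => /andP[/eqP <- _];
  exact: language_factor.
Qed.

Lemma language_catr u v : language X (u ++ v) -> language X v.
Proof.
move=> /languageP[x Xx]; rewrite size_cat factor_cat.
by move=> /eqP; rewrite eqseq_cat ?size_factor// => /andP[_ /eqP <-];
  exact: language_factor.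
Qed.

Lemma language_extend u N : language X u -> (size u <= N)%N ->
  exists v, language X (u ++ v) /\ size (u ++ v) = N.
Proof.
move=> /languageP[x Xx xu] uN; exists (factor x (1 + (size u)%:Z) (N - size u)).
have -> : u ++ factor x (1 + (size u)%:Z) (N - size u) = factor x 1 N.
  by rewrite -{1}xu -factor_cat subnKC.
by split; [exact: language_factor | rewrite size_factor].
Qed.

Lemma complexity_gt0 n : (0 < complexity X n)%N.
Proof.
have [[x Xx] _ _] := subX; apply/card_gt0P.
have fn : size (factor x 1 n) == n by rewrite size_factor.
by exists (Tuple fn); rewrite inE; apply/asboolP; exact: language_factor.
Qed.

Lemma complexity_submul m n :
  (complexity X (m + n) <= complexity X m * complexity X n)%N.
Proof.
rewrite /complexity -cardX -sum1_card (reindex _ (onW_bij _ (@cat_tuple_bij A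
  m n))).
rewrite sum1_card; apply: subset_leq_card; apply/fintype.subsetP => -[u v].
rewrite !inE /= => /asboolP Luv.
apply/andP; split; apply/asboolP;
  [exact: language_catl Luv | exact: language_catr Luv].
Qed.

End Words.

(** * Empirical measures on the words of length N *)

Section Empirical.
Context (R : realType) (A : finType) (a0 : A) (X : set (fullshift a0)).
Hypothesis subX : is_subshift X.
Implicit Types (x y : fullshift a0) (w : seq A) (B : set (fullshift a0)).

Definition witness N (v : N.-tuple A) : fullshift a0 :=
  xget (fun=> a0) [set x | X x /\ factor x 1 N = v].

Lemma witnessP N (v : N.-tuple A) : word_in (language X) v ->
  X (witness v) /\ factor (witness v) 1 N = v.
Proof.
move=> /asboolP/(languageP subX)[x Xx]; rewrite size_tuple => xv.
by apply: (@xgetPex _ (fun=> a0) [set x | X x /\ factor x 1 N = v]); exists x.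
Qed.

(** The empirical measure of order N, the mean of the Dirac masses at the first
    N translates of the chosen points, defined on all sets. *)
Definition frequency N B : R :=
  (\sum_(v : N.-tuple A | word_in (language X) v) \sum_(t < N)
     (`[< B (iter t (@shift A a0) (witness v)) >])%:R) /
  (complexity X N * N)%:R.

Lemma frequency_ge0 N B : 0 <= frequency N B.
Proof. by rewrite divr_ge0// sumr_ge0// => v _; rewrite sumr_ge0. Qed.

Lemma frequencyU N B C : B `&` C = set0 ->
  frequency N (B `|` C) = frequency N B + frequency N C.
Proof.
move=> BC; rewrite -mulrDl -big_split; congr (_ / _).
apply: eq_bigr => v _; rewrite -big_split; apply: eq_bigr => t _ /=.
set z := iter _ _ _; rewrite -natrD; congr _%:R.
have : ~ (B z /\ C z) by move=> BCz; have : (B `&` C) z by []; rewrite BC.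
by rewrite asbool_or; case: asboolP => Bz; case: asboolP => Cz BCz //;
  case: BCz.
Qed.

Lemma frequencyT N : (0 < N)%N -> frequency N setT = 1.
Proof.
move=> N0; rewrite /frequency (eq_bigr (fun=> N%:R)) => [|v _]; last first.
  by rewrite -[in RHS](card_ord N) -sumr_const; apply: eq_bigr => t _;
    rewrite asboolT.
rewrite sumr_const -[_ *+ _]mulr_natl -natrM divff// pnatr_eq0 muln_eq0
  negb_or -!lt0n N0 andbT.
exact: complexity_gt0.
Qed.

Lemma frequency_null N B : B `&` X = set0 -> frequency N B = 0.
Proof.
move=> BX; rewrite /frequency big1 ?mul0r// => v /witnessP[Xv _].
rewrite big1// => t _; rewrite asboolF// => Bz.
suff : (B `&` X) (iter t (@shift A a0) (witness v)) by rewrite BX.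
by split=> //; exact: subshift_iter.
Qed.

Lemma frequency_le1 N B : frequency N B <= 1.
Proof.
have [->|N0] := posnP N.
  by rewrite /frequency muln0 invr0 mulr0.
rewrite -(frequencyT N0) -(setUv B) frequencyU ?setICr// lerDl.
exact: frequency_ge0.
Qed.

(** The sum over translates telescopes, so that the two averages differ by the
    end terms only. *)
Lemma frequency_shift N B :
  `|frequency N (@shift A a0 @^-1` B) - frequency N B| <= N%:R^-1.
Proof.
have [->|N0] := posnP N.
  by rewrite /frequency muln0 !invr0 !mulr0 subr0 normr0.
rewrite -mulrBl -sumrB normrM [X in _ * X]ger0_norm// natrM invfM mulrA
  ler_piMl//.
rewrite ler_pdivrMr ?ltr0n ?complexity_gt0// mul1r.
rewrite (le_trans (ler_norm_sum _ _ _))//.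
rewrite -[leRHS]mulr1 mulr_natl -sumr_const; apply: ler_sum => v _.
set f := fun t => (`[< B (iter t (@shift A a0) (witness v)) >])%:R : R.
rewrite -sumrB (eq_bigr (fun t : 'I_N => f t.+1 - f t))//.
rewrite -(big_mkord xpredT (fun t => f t.+1 - f t)) telescope_sumr//.
by rewrite /f; case: asboolP; case: asboolP => _ _;
  rewrite ?subrr ?subr0 ?sub0r ?normrN ?normr0 ?normr1.
Qed.

Definition read_at N (v : N.-tuple A) (t n : nat) : seq A :=
  factor (witness v) (1 + t%:Z) n.

Lemma read_atE N (v : N.-tuple A) t n :
  word_in (language X) v -> (t + n <= N)%N -> read_at v t n = take n (drop t v).
Proof.
rewrite /read_at => /witnessP[_]; move: (witness v) => x <- tnN.
rewrite -[in RHS](subnKC tnN) -addnA !factor_cat drop_size_cat ?size_factor//.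
by rewrite take_size_cat ?size_factor.
Qed.

(** Integration against the law of the n-word at coordinate 1.  The last
    positions read letters of the chosen point beyond its N-word. *)
Lemma frequency_average N n (g : seq A -> R) :
  \sum_(w : n.-tuple A) frequency N [set x | factor x 1 n = w] * g w =
  (\sum_(v : N.-tuple A | word_in (language X) v)
     \sum_(t < N) g (read_at v t n)) / (complexity X N * N)%:R.
Proof.
under eq_bigr do rewrite mulrAC.
rewrite -mulr_suml; congr (_ / _).
under eq_bigr do rewrite mulr_suml.
rewrite exchange_big; apply: eq_bigr => v _ /=.
under eq_bigr do rewrite mulr_suml.
rewrite exchange_big; apply: eq_bigr => t _ /=.
have sz : size (read_at v t n) == n by rewrite size_factor.
rewrite (bigD1 (Tuple sz))//= big1 ?addr0 => [|w /eqP wt].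
  by rewrite asboolT ?mul1r//= factor_iter_shift.
rewrite asboolF ?mul0r// => /= wE; apply: wt; apply: val_inj => /=.
by rewrite -wE factor_iter_shift.
Qed.

Lemma frequency_factor_gt0 N n (v : N.-tuple A) (t : 'I_N) :
  word_in (language X) v ->
  0 < frequency N [set x | factor x 1 n = read_at v t n].
Proof.
move=> Lv; rewrite divr_gt0//; last first.
  by rewrite ltr0n muln_gt0 complexity_gt0//=; case: t => t; case: N {v Lv}.
rewrite (bigD1 v)//= (bigD1 t)//= asboolT; last by rewrite /= factor_iter_shift.
rewrite -addrA ltr_pwDl// addr_ge0 ?sumr_ge0// => v' _; rewrite ?sumr_ge0//.
Qed.

End Empirical.

(** * Block entropy of the empirical measures *)

Section SumTuples.
Variables (R : realType) (A : finType).

Lemma sum_tuple_cat m n (F : seq A -> R) :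
  \sum_(v : (m + n).-tuple A) F v =
  \sum_(u : m.-tuple A) \sum_(w : n.-tuple A) F (u ++ w).
Proof.
by rewrite (reindex _ (onW_bij _ (@cat_tuple_bij A m n)))/= pair_big.
Qed.

(** The weight of v when its first K consecutive blocks of length n are
    independent with law P. *)
Definition block_product (P : seq A -> R) n K (v : seq A) : R :=
  \prod_(k < K) P (take n (drop (k * n) v)).

Lemma sum_block_product (P : seq A -> R) n K M :
  \sum_(w : n.-tuple A) P w = 1 ->
  \sum_(v : (K * n + M).-tuple A) block_product P n K v = (#|A| ^ M)%:R.
Proof.
move=> P1; elim: K => [|K IH].
  rewrite (eq_bigr (fun=> 1)) => [|v _];
    last by rewrite /block_product big_ord0.
  by rewrite sumr_const card_tuple.
transitivity ((\sum_(u : n.-tuple A) P u) *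
    \sum_(v : (K * n + M).-tuple A) block_product P n K v);
      last by rewrite P1 mul1r.
rewrite mulSn -addnA sum_tuple_cat mulr_suml.
apply: eq_bigr => u _; rewrite mulr_sumr; apply: eq_bigr => w _.
rewrite /block_product big_ord_recl mul0n drop0 take_size_cat ?size_tuple//.
congr (_ * _); apply: eq_bigr => k _.
by rewrite /= mulSn addnC -drop_drop drop_size_cat ?size_tuple.
Qed.

End SumTuples.

Section BlockEntropy.
Context (R : realType) (A : finType) (a0 : A) (X : set (fullshift a0)).
Hypothesis subX : is_subshift X.

Definition block_entropy (P : seq A -> R) n : R :=
  - \sum_(w : n.-tuple A) P w * ln (P w).

Definition word_frequency N (w : seq A) : R :=
  frequency R X N [set x | factor x 1 (size w) = w].

Lemma sum_word_frequency N n : (0 < N)%N ->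
  \sum_(w : n.-tuple A) word_frequency N w = 1.
Proof.
move=> N0; rewrite -(@frequencyT R _ _ _ subX N N0).
transitivity (\sum_(w : n.-tuple A)
    frequency R X N [set x : fullshift a0 | factor x 1 n = w] * 1).
  by apply: eq_bigr => w _; rewrite mulr1 /word_frequency size_tuple.
rewrite (@frequency_average R A a0 X N n (fun=> 1)) /frequency; congr (_ / _).
by apply: eq_bigr => v _; apply: eq_bigr => t _; rewrite asboolT.
Qed.

Lemma word_frequency_factor_gt0 N n (v : N.-tuple A) (t : nat) :
  word_in (language X) v -> (t < N)%N ->
  0 < word_frequency N (read_at X v t n).
Proof.
move=> Lv tN; rewrite /word_frequency size_factor.
exact: (@frequency_factor_gt0 R _ _ _ subX N n v (Ordinal tN) Lv).
Qed.

Lemma word_frequency_ge0 N w : 0 <= word_frequency N w.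
Proof. exact: frequency_ge0. Qed.

Lemma word_frequency_le1 N w : word_frequency N w <= 1.
Proof. exact: frequency_le1. Qed.

(** Gibbs' inequality for the uniform law p on the words of length N, against
    the law q, restricted to these words, that makes the K blocks from offset j
    on independent with the empirical law, and the other N - K n letters
    uniform.  The law q is
    positive on the words of X because each block of such a word has positive
    empirical frequency. *)
Lemma ln_complexity_offset N n K j : (0 < n)%N -> (j + K * n <= N)%N ->
  (0 < N)%N ->
  (complexity X N)%:R * ln (complexity X N)%:R <=
  (complexity X N)%:R * ((N - K * n)%:R * ln #|A|%:R) +
  \sum_(v : N.-tuple A | word_in (language X) v) \sum_(k < K)
     - ln (word_frequency N (read_at X v (k * n + j) n)).
Proof.
move=> n0 jKn N0.
set c := complexity X N;
  have c0 : 0 < c%:R :> R by rewrite ltr0n complexity_gt0.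
have A0 : 0 < #|A|%:R :> R by rewrite ltr0n; apply/card_gt0P; exists a0.
set P := word_frequency N.
pose q (v : N.-tuple A) : R := if word_in (language X) v then
  block_product P n K (drop j v) / (#|A| ^ (N - K * n))%:R else 0.
pose p (v : N.-tuple A) : R := if word_in (language X) v then c%:R^-1 else 0.
have blockE (v : N.-tuple A) : word_in (language X) v ->
  block_product P n K (drop j v) =
    \prod_(k < K) P (read_at X v (k * n + j) n).
  move=> Lv; apply: eq_bigr => k _.
  rewrite read_atE//; last first.
    by have := ltn_ord k; rewrite -(leq_pmul2r n0) mulSn; lia.
  by rewrite drop_drop.
have Pgt0 (v : N.-tuple A) (k : 'I_K) : word_in (language X) v ->
    0 < P (read_at X v (k * n + j) n).
  move=> Lv; apply: word_frequency_factor_gt0 => //.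
  by have := ltn_ord k; rewrite -(leq_pmul2r n0) mulSn; lia.
have block_gt0 (v : N.-tuple A) : word_in (language X) v ->
  0 < block_product P n K (drop j v).
  by move=> Lv; rewrite blockE//; apply: prodr_gt0 => k _; exact: Pgt0.
have Apow m : 0 < (#|A| ^ m)%:R :> R by rewrite natrX exprn_gt0.
have sum_q : \sum_v q v <= 1.
  apply: (@le_trans _ _ (\sum_(v : N.-tuple A)
      block_product P n K (drop j v) / (#|A| ^ (N - K * n))%:R)).
    apply: ler_sum => v _; rewrite /q; case: ifP => // _.
    by rewrite divr_ge0// prodr_ge0// => k _; exact: word_frequency_ge0.
  rewrite -mulr_suml ler_pdivrMr// mul1r.
  have NE : N = (j + (K * n + (N - K * n - j)))%N by lia.
  have -> : \sum_(v : N.-tuple A) block_product P n K (drop j v) =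
      \sum_(v : (j + (K * n + (N - K * n - j))).-tuple A) block_product P n K
        (drop j v).
    by case: _ / NE.
  rewrite (sum_tuple_cat _ _ (fun v => block_product P n K (drop j v))).
  under eq_bigr do under eq_bigr do rewrite drop_size_cat ?size_tuple//.
  under eq_bigr do rewrite sum_block_product ?sum_word_frequency//.
  rewrite sumr_const card_tuple -mulrnA -expnD ler_nat leq_pexp2l//;
    last by lia.
  by apply/card_gt0P; exists a0.
have sum_p : \sum_v p v = 1.
  rewrite /p -big_mkcond/= sumr_const -[_ *+ _]mulr_natl divff// gt_eqF//.
have := @gibbs R _ p q; rewrite sum_p => /(_ _ _ _ sum_q).
have -> : \sum_v p v * ln (q v) =
    c%:R^-1 * \sum_(v : N.-tuple A | word_in (language X) v)
   (\sum_(k < K) ln (P (read_at X v (k * n + j) n))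
    - (N - K * n)%:R * ln #|A|%:R).
  rewrite mulr_sumr [RHS]big_mkcond; apply: eq_bigr => v _; rewrite /p /q.
  case: ifP => [Lv|_]; last by rewrite mul0r.
  congr (_ * _); rewrite ln_div ?posrE ?block_gt0// natrX lnXn// mulr_natl.
  congr (_ - _); rewrite blockE//.
  by rewrite ln_prod// => k; exact: Pgt0.
have -> : \sum_v p v * ln (p v) = - ln c%:R.
  under eq_bigr => v _.
    rewrite (_ : p v * ln (p v) = p v * - ln c%:R); first over.
    by rewrite /p; case: ifP => _; rewrite ?mul0r// lnV// posrE.
  by rewrite -mulr_suml sum_p mul1r.
have q0 v : 0 <= q v by rewrite /q; case: ifP => // Lv;
  rewrite divr_ge0// ltW ?block_gt0.
have p0 v : 0 <= p v by rewrite /p; case: ifP.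
have pq v : 0 < p v -> 0 < q v.
  by rewrite /p /q; case: ifP => [Lv _|]; rewrite ?ltxx// divr_gt0 ?block_gt0.
move=> /(_ p0 q0 pq); rewrite mulrC ler_pdivrMr// sumrB sumr_const.
rewrite -[_ *+ #|_|]mulr_natl -/c.
under [in X in _ -> X]eq_bigr do rewrite sumrN.
rewrite sumrN; lra.
Qed.

Lemma sum_ord_blocks n K (f : nat -> R) :
  \sum_(t < K * n) f t = \sum_(k < K) \sum_(j < n) f (k * n + j)%N.
Proof.
elim: K => [|K IH]; first by rewrite !big_ord0.
by rewrite mulSnr big_split_ord/= IH big_ord_recr.
Qed.

(** Sum of the previous inequality over the offsets j < n.  Each position t is
    the start k n + j of one block, so the block terms add up to at most an
    average over all positions, which is N times the block entropy. *)
Lemma ln_complexity_le_block_entropy N n : (0 < n)%N -> (n <= N)%N ->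
  n%:R * ln (complexity X N)%:R <=
  n%:R * ((2 * n)%:R * ln #|A|%:R) + N%:R * block_entropy (word_frequency N) n.
Proof.
move=> n0 nN; have N0 : (0 < N)%N by exact: leq_trans nN.
set c := complexity X N;
  have c0 : 0 < c%:R :> R by rewrite ltr0n complexity_gt0.
have A1 : 1 <= #|A|%:R :> R by rewrite ler1n; apply/card_gt0P; exists a0.
(* one block less than fits, so that K blocks fit from every offset *)
pose K := (N %/ n).-1.
have Nn0 : (0 < N %/ n)%N by rewrite divn_gt0.
have NE : N = (K * n + n + N %% n)%N.
  by rewrite -mulSnr /K prednK// -divn_eq.
have modn : (N %% n < n)%N by rewrite ltn_mod.
pose g w := - ln (word_frequency N w).
have g0 w : 0 <= g w by rewrite oppr_ge0 ln_le0// word_frequency_le1.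
have entropyE : c%:R * (N%:R * block_entropy (word_frequency N) n) =
    \sum_(v : N.-tuple A | word_in (language X) v)
      \sum_(t < N) g (read_at X v t n).
  rewrite mulrA -natrM mulrC; apply: (canLR (divfK _)).
    by rewrite pnatr_eq0 muln_eq0 negb_or -!lt0n N0 andbT complexity_gt0.
  rewrite -(@frequency_average R A a0 X N n g) /block_entropy -sumrN.
  by apply: eq_bigr => w _; rewrite /g mulrN /word_frequency size_tuple.
rewrite -(ler_pM2l c0) mulrDr entropyE.
have offset (j : 'I_n) : c%:R * ln c%:R <= c%:R * ((2 * n)%:R * ln #|A|%:R) +
    \sum_(v : N.-tuple A | word_in (language X) v)
      \sum_(k < K) g (read_at X v (k * n + j) n).
  have jKn : (j + K * n <= N)%N by have := ltn_ord j; lia.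
  apply: (le_trans (ln_complexity_offset n0 jKn N0)); rewrite lerD2r ler_pM2l//.
  by rewrite ler_wpM2r ?ln_ge0// ler_nat; lia.
rewrite mulrCA [in leRHS]mulrCA.
apply: (@le_trans _ _ (n%:R * (c%:R * ((2 * n)%:R * ln #|A|%:R)) +
  \sum_(j < n) \sum_(v : N.-tuple A | word_in (language X) v)
    \sum_(k < K) g (read_at X v (k * n + j) n))).
  have sum_n (x : R) : n%:R * x =
    \sum_(j < n) x by rewrite sumr_const card_ord mulr_natl.
  rewrite (sum_n (c%:R * ln c%:R)) (sum_n (c%:R * _)) -big_split/=.
  by apply: ler_sum => j _; exact: offset.
rewrite lerD2l exchange_big/=; apply: ler_sum => v _.
rewrite exchange_big/= -(sum_ord_blocks n K (fun t => g (read_at X v t n))).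
rewrite -!(big_mkord xpredT (fun t => g (read_at X v t n))).
rewrite [leRHS](@big_cat_nat _ _ _ (K * n))//=;
  last by rewrite [leqRHS]NE -addnA leq_addr.
by rewrite lerDl sumr_ge0.
Qed.

End BlockEntropy.

(** * Maximal entropy of the ultralimits *)

Section Ultralimit.
Variables (R : realType) (U : set_system nat).
Hypothesis ultraU : UltraFilter U.
Hypothesis eventuallyU : \oo `<=` U.

Let properU : ProperFilter U. Proof. exact: ultra_proper. Qed.
#[local] Existing Instance properU.

(** By compactness the sequence has a cluster point along U, and an ultrafilter
    converges to each of its cluster points. *)
Lemma ultralimit_cvg (f : nat -> R) a b : (forall n, a <= f n <= b) ->
  cvg (f @ U).
Proof.
move=> fab; have : compact `[a, b] by exact: segment_compact.
move=> /(_ (f @ U) _) [].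
  change (U (f @^-1` [set` `[a, b]])).
  by apply: filterE => n; rewrite /= in_itv/=; exact: fab.
move=> p [_ clp]; apply/cvg_ex; exists p => V Vp.
have [//|UnV] := in_ultra_setVsetC (f @^-1` V) ultraU.
have := clp (~` V) V UnV Vp.
by rewrite setICl => -[].
Qed.

Lemma cvg_ultralimit (f : nat -> R) (l : R) : f @ \oo --> l -> f @ U --> l.
Proof.
by move=> fl; apply: cvg_trans fl; exact: (cvg_app f eventuallyU).
Qed.

End Ultralimit.

Section Entropy.
Context (R : realType) (A : finType) (a0 : A) (X : set (fullshift a0)).
Hypothesis subX : is_subshift X.
Let h : R := topological_entropy R X.

Lemma topological_entropyP :
  (fun n => ln (complexity X n)%:R / n%:R : R) @ \oo --> h /\
  forall n, n%:R * h <= ln (complexity X n)%:R.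
Proof.
have c0 n : 0 < (complexity X n)%:R :> R by rewrite ltr0n complexity_gt0.
apply: fekete => [n|m n]; first by rewrite ln_ge0// ler1n complexity_gt0.
rewrite -lnM ?posrE// ler_ln ?posrE ?mulr_gt0// -natrM ler_nat.
exact: complexity_submul.
Qed.

Lemma topological_entropy_ge0 : 0 <= h.
Proof.
have [ch _] := topological_entropyP; rewrite -(cvg_lim _ ch)//.
apply: limr_ge; first by apply/cvg_ex; exists h.
by apply: nearW => n; rewrite divr_ge0// ln_ge0// ler1n complexity_gt0.
Qed.

(** Gibbs' inequality against the uniform law on the words of X. *)
Lemma block_entropy_le_complexity (P : seq A -> R) n :
  (forall w, 0 <= P w) -> (forall w, ~ language X w -> P w = 0) ->
  \sum_(w : n.-tuple A) P w = 1 ->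
  block_entropy P n <= ln (complexity X n)%:R.
Proof.
move=> P0 PX P1.
have c0 : 0 < (complexity X n)%:R :> R by rewrite ltr0n complexity_gt0.
pose q (w : n.-tuple A) : R :=
  if word_in (language X) w then (complexity X n)%:R^-1 else 0.
have sum_q : \sum_w q w = 1.
  rewrite /q -big_mkcond/= sumr_const -[_ *+ _]mulr_natl divff// gt_eqF//.
have := @gibbs R _ (fun w : n.-tuple A => P w) q;
  rewrite P1 sum_q => /(_ _ _ _ (lexx _)).
have -> : \sum_(w : n.-tuple A) P w * ln (q w) = - ln (complexity X n)%:R.
  transitivity (\sum_(w : n.-tuple A) P w * - ln (complexity X n)%:R).
    2: by rewrite -mulr_suml P1 mul1r.
  apply: eq_bigr => w _.
  rewrite /q /word_in; case: asboolP => Lw; first by rewrite lnV ?posrE.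
  by rewrite PX// !mul0r.
rewrite /block_entropy lerNl => cross; apply: cross => // w.
  by rewrite /q; case: ifP.
by rewrite /q /word_in; case: asboolP => [_ _|/PX ->]; rewrite ?invr_gt0// ltxx.
Qed.

(** The tangent bound - x ln x <= - x ln q + q - x, with q = P w, majorizes the
    block entropies of the empirical laws by functions linear in the
    frequencies, whose limits are immediate.  Where P w = 0 the tangent at
    a small d replaces the vertical one. *)
Lemma block_entropy_ultralimit (U : set_system nat) (P : seq A -> R) n :
  UltraFilter U -> \oo `<=` U -> (0 < n)%N ->
  (forall w, 0 <= P w) ->
  (forall w, (fun N => word_frequency R X N w) @ U --> P w) ->
  n%:R * h <= block_entropy P n.
Proof.
move=> ultraU ooU n0 P0 PN.
have properU : ProperFilter U by exact: ultra_proper.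
have [_ hc] := topological_entropyP.
pose freq := word_frequency R X.
apply/ler_addgt0Pr => e e0.
pose d := e / (#|{: n.-tuple A}|%:R + 1).
have d0 : 0 < d by rewrite divr_gt0// ltr_wpDl.
pose q (w : seq A) : R := if P w == 0 then d else P w.
have q0 w : 0 < q w.
  by rewrite /q; case: ifPn => // Pw; rewrite lt_def Pw P0.
pose B (N : nat) : R := (n%:R * ((2 * n)%:R * ln #|A|%:R)) / N%:R +
  \sum_(w : n.-tuple A) (- (freq N w * ln (q w)) + (q w - freq N w)).
have hB : \forall N \near \oo, n%:R * h <= B N.
  near=> N.
  have nN : (n <= N)%N by near: N; exact: nbhs_infty_ge.
  have N0 : 0 < N%:R :> R by rewrite ltr0n (leq_trans n0).
  have := ln_complexity_le_block_entropy R subX n0 nN.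
  have := hc N; rewrite -(ler_pM2l (_ : 0 < n%:R)) ?ltr0n// => h1 h2.
  have HB : block_entropy (freq N) n <=
      \sum_(w : n.-tuple A) (- (freq N w * ln (q w)) + (q w - freq N w)).
    rewrite /block_entropy -sumrN; apply: ler_sum => w _.
    have := gibbs_term (word_frequency_ge0 R X N w) (ltW (q0 w)) (fun=> q0 w).
    rewrite -/freq.
    lra.
  rewrite -(ler_pM2l N0) in HB.
  rewrite /B -(ler_pM2l N0) mulrDr [N%:R * (_ / _)]mulrC divfK ?gt_eqF//.
  have := le_trans h1 h2; rewrite [n%:R * (N%:R * h)]mulrCA; lra.
have cB : B @ U --> \sum_(w : n.-tuple A) (- (P w * ln (q w)) + (q w - P w)).
  rewrite -[X in _ --> X]add0r; apply: cvgD.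
    apply: cvg_ultralimit => //.
    rewrite -[X in _ --> X](mulr0 (n%:R * ((2 * n)%:R * ln #|A|%:R))).
    apply: cvgMl_tmp; rewrite -cvg_shiftS; exact: cvg_harmonic.
  apply: cvg_big => [|w _]; first exact: add_continuous.
  apply: cvgD; first by apply: cvgN; apply: cvgMr_tmp; exact: PN.
  by apply: cvgB; [exact: cvg_cst|exact: PN].
have : n%:R * h <= \sum_(w : n.-tuple A) (- (P w * ln (q w)) + (q w - P w)).
  rewrite -(cvg_lim _ cB)//; apply: limr_ge; first by apply/cvg_ex; eexists;
    exact: cB.
  exact: ooU.
move=> /le_trans; apply; rewrite /block_entropy -sumrN.
apply: (@le_trans _ _ (\sum_(w : n.-tuple A) (- (P w * ln (P w)) + d))).
  apply: ler_sum => w _; rewrite /q; case: eqP => [->|_].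
    by rewrite !mul0r subr0.
  by rewrite lerD2l subrr ltW.
rewrite big_split/= lerD2l sumr_const.
have : d * #|{: n.-tuple A}|%:R <= e.
  rewrite /d mulrAC ler_pdivrMr ?ltr_wpDl//.
  by rewrite ler_pM2l// lerDl.
by rewrite mulr_natr.
Unshelve. all: by end_near. Qed.

End Entropy.

Section LimitMeasure.
Context (R : realType) (A : finType) (a0 : A) (X : set (fullshift a0)).
Hypothesis subX : is_subshift X.
Let h : R := topological_entropy R X.

Lemma measure_setI_full (nu : probability (borel_fullshift a0) R)
    (C : set (borel_fullshift a0)) :
  nu X = 1%E -> measurable C -> nu (X `&` C) = nu C.
Proof.
have mX : measurable (X : set (borel_fullshift a0)).
  by case: subX => _ cX _; exact: measurable_closed.
move=> nuX mC.
have nuC : nu C = (nu (C `\` X) + nu (C `&` X))%E := measureDI nu mC mX.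
have nuXC : nu (~` X) = 0%E by rewrite probability_setC// nuX subee.
have nuCX : nu (C `\` X) = 0%E.
  apply: (@subset_measure0 _ _ _ nu _ (~` X)) => //; first exact: measurableD.
  exact: measurableC.
by rewrite nuC nuCX add0e setIC.
Qed.

Lemma cylinder_measure (nu : probability (borel_fullshift a0) R) (w : seq A) :
  nu X = 1%E -> nu (cylinder X w) =
    nu [set x : fullshift a0 | factor x 1 (size w) = w].
Proof.
by move=> nuX; apply: measure_setI_full => //; apply: measurable_clopen;
  exact: factor_clopen.
Qed.

(** Lower bounds on frequencies hold in the limit for every word: this is how
    counting occurrences gives information on the measure of maximal
    entropy. *)
Lemma frequency_limit_MME : exists nu : probability (borel_fullshift a0) R,
  [/\ is_MME X nu,
    forall n, (0 < n)%N ->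
      n%:R * h <= block_entropy (fun w => fine (nu (cylinder X w))) n
    & forall w d, (\forall N \near \oo, d <= word_frequency R X N w) ->
      (d%:E <= nu (cylinder X w))%E].
Proof.
have [U [ultraU ooU]] := @ultraFilterLemma nat \oo _.
have properU : ProperFilter U by exact: ultra_proper.
have [_ cX _] := subX.
have cvgF B : cvg ((fun N => frequency R X N B) @ U).
  apply: (@ultralimit_cvg _ _ ultraU _ 0 1) => N.
  by rewrite frequency_ge0 frequency_le1.
pose m B : R := lim ((fun N => frequency R X N B) @ U).
have m_ge0 B : 0 <= m B.
  by apply: limr_ge => //; apply: nearW => N; exact: frequency_ge0.
have mU B C : B `&` C = set0 -> m (B `|` C) = m B + m C.
  move=> BC; rewrite /m -limD//; congr (lim (_ @ U)).
  by apply/funext => N; exact: frequencyU.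
have mT : m setT = 1.
  apply: cvg_lim => //; apply: cvg_ultralimit => //.
  apply: cvg_near_cst; near=> N; apply: frequencyT => //.
  by near: N; exact: nbhs_infty_gt.
have minv B : m (@shift A a0 @^-1` B) = m B.
  apply/eqP; rewrite -subr_eq0; apply/eqP; rewrite /m -limB//.
  apply: cvg_lim => //; apply: cvg_ultralimit => //.
  apply: norm_cvg0; apply: (@squeeze_cvgr _ _ _ _ (fun=> 0) (fun N => N%:R^-1)).
  - by apply: nearW => N; rewrite normr_ge0 frequency_shift.
  - exact: cvg_cst.
  - by rewrite -cvg_shiftS; exact: cvg_harmonic.
have [nu [nu_inv nuE]] := invariant_extension (fun B _ => m_ge0 B)
  (fun B C _ _ => mU B C) mT (fun B _ => minv B).
have nuX : nu X = 1%E.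
  apply: null_complement_closed => // B cB BX; rewrite nuE//; congr _%:E.
  apply: cvg_lim => //; apply: cvg_near_cst; apply: nearW => N.
  exact: frequency_null.
pose P (w : seq A) : R := m [set x | factor x 1 (size w) = w].
have nuP w : nu (cylinder X w) = (P w)%:E.
  by rewrite cylinder_measure// nuE//; exact: factor_clopen.
have PE : (fun w => fine (nu (cylinder X w))) = P.
  by apply/funext => w; rewrite nuP.
have entropy_ge n : (0 < n)%N -> n%:R * h <= block_entropy P n.
  move=> n0; apply: (block_entropy_ultralimit subX (U := U)) => // w.
    exact: m_ge0.
  exact: cvgF.
have entropy_le n : block_entropy P n <= ln (complexity X n)%:R.
  apply: block_entropy_le_complexity => //.
  - by move=> w; exact: m_ge0.
  - move=> w Lw; apply: cvg_lim => //; apply: cvg_near_cst; apply: nearW => N.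
    apply: frequency_null => //; apply/seteqP; split => // x [/= xw Xx];
      apply: Lw.
    by rewrite -xw; exact: language_factor.
  have : (\sum_(w : n.-tuple A) word_frequency R X N w) @[N --> U] -->
    \sum_(w : n.-tuple A) P w.
    by apply: cvg_big => [|w _]; [exact: add_continuous|exact: cvgF].
  move=> /cvg_lim <- //; apply: cvg_lim => //; apply: cvg_ultralimit => //.
  apply: cvg_near_cst; near=> N; apply: sum_word_frequency => //.
  by near: N; exact: nbhs_infty_gt.
exists nu; rewrite PE; split => //.
- split => //; rewrite /measure_entropy.
  apply: cvg_lim => //.
  have [ch hc] := topological_entropyP R subX.
  apply: (@squeeze_cvgr _ _ _ _ (fun=> h) (fun n =>
    ln (complexity X n)%:R / n%:R)) => //.
    near=> n; have n0 : (0 < n)%N by near: n; exact: nbhs_infty_gt.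
    have -> : - (\sum_(w : n.-tuple A)
        fine (nu (cylinder X w)) * ln (fine (nu (cylinder X w)))) =
        block_entropy P n.
      by rewrite -PE.
    by rewrite ler_pdivlMr ?ltr0n// mulrC entropy_ge//=
      ler_pM2r ?invr_gt0 ?ltr0n// entropy_le.
  exact: cvg_cst.
- move=> w d dw; rewrite nuP lee_fin; apply: limr_ge; first exact: cvgF.
  exact: ooU.
Unshelve. all: by end_near. Qed.

End LimitMeasure.

(** * Sets of words of positive measure are large *)

Section LargeSets.
Variable R : realType.

Lemma card_gt0_sum (I : finType) (p : I -> R) (G : pred I) :
  0 < \sum_(i | G i) p i -> 0 < #|G|%:R :> R.
Proof.
move=> pG; rewrite ltr0n; apply/card_gt0P/existsP; apply: contraLR pG.
by move=> /existsPn nG; rewrite -leNgt big1// => i Gi; have := nG i;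
  rewrite -topredE /= Gi.
Qed.

Lemma sum_half_inverse (k : nat) : (2 * k%:R)^-1 *+ k <= 2^-1 :> R.
Proof.
have [->|k0] := eqVneq k 0%N; first by rewrite mulr0n invr_ge0.
by rewrite -[_ *+ k]mulr_natr invfM -mulrA mulVf ?mulr1// pnatr_eq0.
Qed.

(** Gibbs' inequality against a subprobability q that spreads half of its mass
    uniformly over G, and at most the other half over the rest of L; ln 2 is the
    price of the halving. *)
Lemma entropy_le_split (I : finType) (p : I -> R) (G L : pred I) :
  (forall i, 0 <= p i) -> \sum_i p i = 1 -> (forall i, ~~ L i -> p i = 0) ->
  0 < \sum_(i | G i) p i ->
  - (\sum_i p i * ln (p i)) <= ln 2 + (\sum_(i | G i) p i) * ln #|G|%:R +
     (1 - \sum_(i | G i) p i) * ln #|L|%:R.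
Proof.
move=> p0 p1 pL; set t := \sum_(i | G i) p i => t0.
have tE : 1 - t = \sum_(i | ~~ G i) p i.
  by rewrite -p1 (bigID G)/= -/t addrAC subrr add0r.
have L0 i : 0 < p i -> L i by apply: contraTT => /pL ->; rewrite ltxx.
have b0 := card_gt0_sum t0.
have aL i : L i -> 0 < #|L|%:R :> R by move=> Li; rewrite ltr0n;
  apply/card_gt0P; exists i.
pose q i : R := if G i then (2 * #|G|%:R)^-1 else if L i then (2 * #|L|%:R)^-1
  else 0.
have q0 i : 0 <= q i.
  by rewrite /q; do 2! case: ifP => _ //; rewrite invr_ge0 mulr_ge0.
have pq i : 0 < p i -> 0 < q i.
  move=> /L0 Li; rewrite /q Li; case: ifP => _; rewrite invr_gt0 mulr_gt0//.
  exact: aL Li.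
have sum_q : \sum_i q i <= \sum_i p i.
  rewrite p1 (bigID G)/= (eq_bigr (fun=> (2 * #|G|%:R)^-1));
    last by move=> i Gi; rewrite /q Gi.
  rewrite sumr_const; have := sum_half_inverse #|G|.
  suff : \sum_(i | ~~ G i) q i <= 2^-1 by lra.
  apply: (@le_trans _ _ (\sum_(i | L i) (2 * #|L|%:R)^-1)).
    rewrite [leRHS]big_mkcond [leLHS]big_mkcond; apply: ler_sum => i _;
      rewrite /q.
    by case: (G i) => /=; case: (L i) => //; rewrite invr_ge0 mulr_ge0.
  by rewrite sumr_const; exact: sum_half_inverse.
have := gibbs p0 q0 pq sum_q; rewrite lerNl => cross; apply: le_trans cross.
rewrite (bigID G)/=.
rewrite (eq_bigr (fun i => p i * - (ln 2 + ln #|G|%:R))); last first.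
  by move=> i Gi; rewrite /q Gi lnV ?posrE ?mulr_gt0// lnM ?posrE.
rewrite [X in _ <= _ + X](eq_bigr (fun i => p i * - (ln 2 + ln #|L|%:R)));
  last first.
  move=> i nGi; rewrite /q (negbTE nGi); case: ifPn => [Li|/pL ->];
    last by rewrite !mul0r.
  by rewrite lnV ?posrE ?mulr_gt0 ?(aL _ Li)// lnM ?posrE ?(aL _ Li).
rewrite -!mulr_suml -tE -/t; lra.
Qed.

(** By the previous bound, a small G would make the entropy smaller than E: with
    t the mass of G, it reads t (E - ln |G|) <= ln 2 + (1 - t) ln C. *)
Lemma card_large_set (I : finType) (p : I -> R) (G L : pred I) (C eps E : R) :
  (forall i, 0 <= p i) -> \sum_i p i = 1 -> (forall i, ~~ L i -> p i = 0) ->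
  0 < eps -> eps <= \sum_(i | G i) p i -> 1 <= C ->
  #|L|%:R <= C * expR E -> E <= - (\sum_i p i * ln (p i)) ->
  expR (- ((ln 2 + ln C) / eps)) * expR E <= #|G|%:R.
Proof.
move=> p0 p1 pL eps0 epst C1 LC EH.
have t0 : 0 < \sum_(i | G i) p i by exact: lt_le_trans epst.
have := le_trans EH (entropy_le_split p0 p1 pL t0).
have t1 : \sum_(i | G i) p i <= 1.
  by rewrite -p1 [leRHS](bigID G)/= lerDl sumr_ge0.
have b0 := card_gt0_sum t0.
have a0 : 0 < #|L|%:R :> R.
  apply: (@card_gt0_sum _ p); suff -> : \sum_(i | L i) p i = 1 by [].
  by rewrite -p1 [RHS](bigID L)/= [X in _ = _ + X]big1 ?addr0// => i; exact: pL.
have C0 : 0 < C by lra.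
have lnL : ln #|L|%:R <= ln C + E.
  by rewrite -[E]expRK -lnM ?posrE ?expR_gt0// ler_ln ?posrE ?mulr_gt0
    ?expR_gt0.
have lnC := ln_ge0 C1.
have ln2 : 0 <= ln 2 :> R by apply: ln_ge0; lra.
set t := \sum_(i | G i) p i in epst t0 t1 *; set b := ln #|G|%:R => H.
rewrite -expRD -[leRHS]lnK ?posrE// ler_expR -/b.
suff : (E - b) <= (ln 2 + ln C) / eps by lra.
rewrite ler_pdivlMr//.
have : (E - b) * t <= ln 2 + ln C by nra.
have [Eb|Eb] := leP 0 (E - b); nra.
Qed.

End LargeSets.

(** * Occurrences of a glued word *)

Definition occurs_at (A : finType) (a0 : A) (X : set (fullshift a0)) N
    (w : seq A) (t : nat) : pred (N.-tuple A) :=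
  fun s => word_in (language X) s && (take (size w) (drop t s) == w).
Arguments occurs_at {A a0} X N w t.

Section CountOccurrences.
Context (A : finType) (a0 : A) (X : set (fullshift a0)).
Hypothesis subX : is_subshift X.
Variables (G : set (seq A)) (r : nat).
Hypothesis gluing : forall u v w : seq A, G u -> G v -> G w ->
  exists y z : seq A, [/\ size y = r, size z = r
    & language X (u ++ y ++ v ++ z ++ w)].

(** From the glued word u y w z v, extended to length N, the pair (u, v) is
    recovered by reading at fixed positions. *)
Lemma card_occurrences (w : seq A) (N i j : nat) : G w ->
  (i + r + size w + r + j <= N)%N ->
  (#|@word_in A G i| * #|@word_in A G j| <=
   #|occurs_at X N w (i + r)|)%N.
Proof.
move=> Gw ijN; rewrite -cardX.
have [|f fP] := @choice (i.-tuple A * j.-tuple A) (N.-tuple A) (fun p s =>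
    G p.1 -> G p.2 -> [/\ language X s, take i s = p.1,
      take (size w) (drop (i + r) s) = w &
      take j (drop (i + r + size w + r) s) = p.2]).
  move=> [u v] /=.
  have [Gu|nGu] := pselect (G u); last by exists [tuple of nseq N a0] => /nGu.
  have [Gv|nGv] := pselect (G v); last by exists [tuple of nseq N a0] => _ /nGv.
  have [y [z [yr zr Luv]]] := gluing Gu Gw Gv.
  have uN : (size (tval u ++ y ++ w ++ z ++ v) <= N)%N.
    by rewrite !size_cat !size_tuple yr zr; lia.
  have [x [Lx xN]] := language_extend subX Luv uN.
  move/eqP : xN => xN; exists (Tuple xN) => _ _ /=; rewrite -!catA.
  split; first by move: Lx; rewrite -!catA.
  - by rewrite take_size_cat ?size_tuple.
  - by rewrite catA drop_size_cat ?size_cat ?size_tuple ?yr// take_size_cat.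
  - rewrite (catA w) (catA y) (catA (tval u)) -catA.
    rewrite catA drop_size_cat ?take_size_cat ?size_tuple//.
    by rewrite !size_cat size_tuple yr zr; lia.
rewrite -(card_in_image (f := f)); last first.
  move=> [u v] [u' v']; rewrite !inE /= =>
    /andP[/asboolP Gu /asboolP Gv] /andP[/asboolP Gu' /asboolP Gv'] ff.
  have [_ fu _ fv] := fP (u, v) Gu Gv;
    have [_ fu' _ fv'] := fP (u', v') Gu' Gv'.
  by congr (_, _); apply: val_inj; rewrite /= -?fu -?fu' -?fv -?fv' ff.
apply: subset_leq_card; apply/fintype.subsetP => s /fintype.imageP[[u v] uv ->].
move: uv; rewrite !inE /= => /andP[/asboolP Gu /asboolP Gv].
have [Lf _ fw _] := fP (u, v) Gu Gv.
by apply/andP; split; [exact/asboolP|exact/eqP].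
Qed.

End CountOccurrences.

Section WordFrequencyLowerBound.
Context (R : realType) (A : finType) (a0 : A) (X : set (fullshift a0)).
Hypothesis subX : is_subshift X.

Lemma word_frequency_ge (N : nat) (w : seq A) : (0 < N)%N ->
  (\sum_(t < N | (t + size w <= N)%N)
     #|occurs_at X N w t|)%:R
    / (complexity X N * N)%:R <= word_frequency R X N w.
Proof.
move=> N0; rewrite ler_wpM2r ?invr_ge0// natr_sum exchange_big/=
  [leLHS]big_mkcond.
apply: ler_sum => t _; case: ifP => twN; last by rewrite sumr_ge0.
rewrite -sum1_card natr_sum/= [leLHS]big_mkcond [leRHS]big_mkcond/=.
apply: ler_sum => v _; rewrite unfold_in; case: ifPn => [/andP[Lv vw]|_];
  last by case: ifP.
rewrite Lv asboolT//= factor_iter_shift -/(read_at X v t _) read_atE//.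
exact/eqP.
Qed.

Variables (G : set (seq A)) (r : nat).
Hypothesis gluing : forall u v w : seq A, G u -> G v -> G w ->
  exists y z : seq A, [/\ size y = r, size z = r
    & language X (u ++ y ++ v ++ z ++ w)].
Variables (S : set nat) (M : nat) (C kappa h : R).
Hypothesis syndeticS : forall k : nat,
  exists2 n : nat, (k <= n < k + M)%N & S n.
Hypothesis h0 : 0 <= h.
Hypothesis kappa0 : 0 < kappa.
Hypothesis many_in_G : forall n, S n ->
  kappa * expR (n%:R * h) <= #|@word_in A G n|%:R.
Hypothesis few_words : forall n, (complexity X n)%:R <= C * expR (n%:R * h).

(** Positions t = i + r with i in S and i < T M are used, one for each of the
    T windows of length M; a second length j in S then loses less than M
    letters.  The bound on N makes T M at least N / 2. *)
Lemma word_frequency_lower_bound (w : seq A) (N : nat) : G w ->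
  (2 * (size w + 2 * r + 2 * M) <= N)%N ->
  kappa ^+ 2 * expR (- ((2 * r + M)%:R * h)) / (2 * M%:R * C) *
    expR (- ((size w)%:R * h)) <= word_frequency R X N w.
Proof.
move=> Gw Nlarge.
have M0 : (0 < M)%N by have [n] := syndeticS 0; lia.
have N0 : (0 < N)%N by lia.
(* W letters at most are lost to w, to the two gaps and to the choice of j *)
pose W := (size w + 2 * r + M)%N; pose T := ((N - W) %/ M)%N.
have TM : (T * M <= N - W)%N by exact: leq_trunc_div.
have NT : (N <= 2 * (T * M))%N.
  by have := divn_eq (N - W) M; have := ltn_pmod (N - W) M0; rewrite -/T /W;
    lia.
have C0 : 0 < C.
  have c0 : 0 < (complexity X 0)%:R :> R by rewrite ltr0n complexity_gt0.
  by have := lt_le_trans c0 (few_words 0); rewrite mul0r expR0 mulr1.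
set occ := fun t => #|occurs_at X N w t|.
have occ_ge i : S i -> (i < T * M)%N ->
  kappa ^+ 2 * expR ((N - W)%:R * h) <= (occ (i + r)%N)%:R.
  move=> Si iTM.
  have [j jN Sj] := syndeticS (N - W - i).
  have occ_card := @card_occurrences A a0 X subX G r gluing w N i j Gw _.
  apply: (@le_trans _ _ (#|@word_in A G i| * #|@word_in A G j|)%:R); last first.
    by rewrite ler_nat; apply: occ_card; rewrite /W in jN TM *; lia.
  rewrite natrM; apply: (@le_trans _ _ ((kappa * expR (i%:R * h)) * (kappa *
    expR (j%:R * h)))).
    rewrite mulrACA -expr2 -expRD -mulrDl ler_pM2l ?exprn_gt0// ler_expR.
    by rewrite ler_wpM2r// -natrD ler_nat; lia.
  have bound_ge0 x : 0 <= kappa * expR x by rewrite mulr_ge0 ?expR_ge0// ltW.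
  by apply: ler_pM => //; exact: many_in_G.
have sum_ge : T%:R * (kappa ^+ 2 * expR ((N - W)%:R * h)) <=
    (\sum_(t < N | (t + size w <= N)%N) occ t)%:R.
  apply: (@le_trans _ _ (\sum_(t < T * M) (occ (t + r)%N)%:R)).
    rewrite (sum_ord_blocks M T (fun t => (occ (t + r)%N)%:R : R)).
    rewrite mulr_natl -[X in _ *+ X](card_ord T) -sumr_const;
      apply: ler_sum => b _.
    have [i /andP[bi ib] Si] := syndeticS (b * M).
    have ibM : (i - b * M < M)%N by lia.
    rewrite (bigD1 (Ordinal ibM))//= subnKC//.
    have iTM : (i < T * M)%N.
      by have := ltn_ord b; rewrite -(leq_pmul2r M0) mulSn; lia.
    by apply: (le_trans (occ_ge i Si iTM)); rewrite lerDl sumr_ge0.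
  rewrite -natr_sum ler_nat.
  have rTN : (r + T * M <= N)%N by rewrite /W in TM; lia.
  rewrite -(big_mkord xpredT (fun t => occ (t + r)%N)).
  rewrite -(big_mkord (fun t => t + size w <= N)%N).
  have -> : (\sum_(0 <= t < T * M) occ (t + r)%N =
      \sum_(r <= t < r + T * M | (t + size w <= N)%N) occ t)%N.
    rewrite -{2}(add0n r) big_addn addKn big_nat_cond [RHS]big_nat_cond.
    apply: eq_bigl => t; case: (ltnP t (T * M)) => //=.
    by move=> tTM; apply/esym; rewrite /W in TM; lia.
  rewrite [leqRHS](@big_cat_nat _ _ _ r)//=; last by lia.
  rewrite [X in (_ <= _ + X)%N](@big_cat_nat _ _ _ (r + T * M))//=; last by lia.
  by rewrite addnCA leq_addr.
apply: le_trans (word_frequency_ge w N0).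
have cN0 : 0 < (complexity X N * N)%:R :> R by rewrite ltr0n muln_gt0
  complexity_gt0.
rewrite ler_pdivlMr//; apply: le_trans sum_ge.
have TR : 0 < 2 * M%:R * C by rewrite !mulr_gt0 ?ltr0n.
have E : expR ((N - W)%:R * h) =
  expR (N%:R * h) * expR (- ((2 * r + M)%:R * h)) * expR (- ((size w)%:R * h)).
  rewrite -!expRD; congr expR; rewrite natrB /W ?natrD; last by lia.
  by ring.
have NR : N%:R <= 2 * (T%:R * M%:R) :> R by rewrite -!natrM ler_nat.
rewrite E; set e1 := expR (- ((2 * r + M)%:R * h));
  set e2 := expR (- ((size w)%:R * h)).
set eN := expR (N%:R * h).
have cN : (complexity X N)%:R <= C * eN by exact: few_words.
have -> : kappa ^+ 2 * e1 / (2 * M%:R * C) * e2 * (complexity X N * N)%:R =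
  kappa ^+ 2 * e1 * e2 * (((complexity X N)%:R * N%:R) / (2 * M%:R * C)).
  by rewrite natrM; ring.
have -> : T%:R * (kappa ^+ 2 * (eN * e1 * e2)) =
  kappa ^+ 2 * e1 * e2 * (T%:R * eN) by ring.
apply: ler_wpM2l; first by rewrite !mulr_ge0 ?expR_ge0// ltW.
rewrite ler_pdivrMr//.
have -> : T%:R * eN * (2 * M%:R * C) = (C * eN) * (2 * (T%:R * M%:R)) by ring.
exact: ler_pM.
Qed.

End WordFrequencyLowerBound.

Section CylinderUnion.
Context (R : realType) (A : finType) (a0 : A) (X : set (fullshift a0)).
Hypothesis subX : is_subshift X.
Variable mu : probability (borel_fullshift a0) R.

Lemma measurable_cylinder w :
  measurable (cylinder X w : set (borel_fullshift a0)).
Proof.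
apply: measurableI; last by apply: measurable_clopen; exact: factor_clopen.
by case: subX => _ cX _; exact: measurable_closed.
Qed.

Lemma cylinder_unionE (G : set (seq A)) n :
  mu (cylinder_union X (words_of_length G n)) =
  (\sum_(w : n.-tuple A | @word_in A G n w) fine (mu (cylinder X w)))%:E.
Proof.
set D := [seq w <- index_enum {: n.-tuple A} | @word_in A G n w].
have DE (w : n.-tuple A) :
  (w \in D) = `[< G w >] by rewrite mem_filter mem_index_enum andbT.
have -> : cylinder_union X (words_of_length G n) =
  \bigcup_(w in [set` D]) cylinder X w.
  apply/seteqP; split=> x.
    by move=> [w [Gw /eqP wn] xw]; exists (Tuple wn) => //=; rewrite DE;
      exact/asboolP.
  move=> [w /=]; rewrite DE => /asboolP Gw xw.
  by exists w => //; split=> //; rewrite size_tuple.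
rewrite (@measure_fin_bigcup _ _ _ mu _ [set` D] (fun w => cylinder X w)).
- rewrite -fsbig_seq ?filter_uniq ?index_enum_uniq// big_filter -sumEFin.
  apply: eq_bigr => w _; rewrite fineK// fin_num_measure//.
  exact: measurable_cylinder.
- exact: finite_seq.
- move=> v w _ _ [x [[_ xv] [_ xw]]]; apply: val_inj.
  by rewrite /= -xv -xw !size_tuple.
- by move=> w _; exact: measurable_cylinder.
Qed.

Lemma sum_cylinder n : mu X = 1%E ->
  \sum_(w : n.-tuple A) fine (mu (cylinder X w)) = 1.
Proof.
move=> muX; apply: EFin_inj.
rewrite -muX (eq_bigl (@word_in A setT n)); last by move=> w;
  rewrite /word_in asboolT.
rewrite -cylinder_unionE; congr (mu _); apply/seteqP; split=> x;
  first by case=> w _ [].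
by move=> Xx; exists (factor (x : fullshift a0) 1 n); split;
  rewrite ?size_factor.
Qed.

End CylinderUnion.

Theorem theorem3p4 (R : realType) (A : finType) (a0 : A)
    (X : set (fullshift a0)) (mu : probability (borel_fullshift a0) R)
    (G : set (seq A)) (r : nat)
    (hX : is_subshift X)
    (hmu : is_unique_MME X mu)
    (h1 : exists C : R, forall n : nat,
      (complexity X n)%:R < C * expR (n%:R * topological_entropy R X))
    (hG : G `<=` language X)
    (h2 : forall u v w : seq A, G u -> G v -> G w ->
      exists y z : seq A, [/\ size y = r, size z = r
        & language X (u ++ y ++ v ++ z ++ w)])
    (h3 : exists eps : R, 0 < eps /\ exists S : set nat, syndetic S /\
      forall n : nat, S n ->
        (eps%:E < mu (cylinder_union X (words_of_length G n)))%E) :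
  exists D : R, 0 < D /\ forall w : seq A, G w ->
    ((D * expR (- ((size w)%:R * topological_entropy R X)))%:E
      <= mu (cylinder X w))%E.
Proof.
have [C few_words] := h1; have [eps [eps0 [S [[M syndeticS] largeG]]]] := h3.
set h := topological_entropy R X in few_words *.
have [[_ muX _] unique] := hmu.
have [nu [nuMME nu_entropy nu_ge]] := frequency_limit_MME R hX.
have nu_mu w : nu (cylinder X w) = mu (cylinder X w).
  by apply: unique => //; exact: measurable_cylinder.
pose p w : R := fine (mu (cylinder X w)).
have pE : (fun w => fine (nu (cylinder X w))) = p.
  by apply/funext => w; rewrite nu_mu.
have mu_cyl_le1 w : p w <= 1.
  rewrite -lee_fin fineK ?fin_num_measure//; last exact: measurable_cylinder.
  by apply: probability_le1; exact: measurable_cylinder.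
have p0 w : 0 <= p w by exact: fine_ge0.
have M0 : (0 < M)%N by have [n] := syndeticS 0%N; lia.
have C1 : 1 <= C.
  have := few_words 0%N; rewrite mul0r expR0 mulr1 => /ltW; apply: le_trans.
  by rewrite ler1n complexity_gt0.
pose kappa := expR (- ((ln 2 + ln C) / eps)).
have many_in_G n : S n -> kappa * expR (n%:R * h) <= #|@word_in A G n|%:R.
  move=> Sn; apply: (@card_large_set _ _
    (fun w : n.-tuple A => p w) _ (@word_in A (language X) n)) => //.
  - exact: sum_cylinder.
  - move=> w /asboolPn Lw; rewrite /p (_ : cylinder X w = set0) ?measure0//.
    apply/seteqP; split=> // x [Xx xw]; apply: Lw; rewrite -xw.
    exact: language_factor.
  - by rewrite -lee_fin -cylinder_unionE// ltW// largeG.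
  - exact/ltW/few_words.
  - have [->|n0] := posnP n; last by have := nu_entropy _ n0; rewrite pE.
    rewrite mul0r -sumrN sumr_ge0// => w _.
    by rewrite -mulrN mulr_ge0// oppr_ge0 ln_le0.
exists (kappa ^+ 2 * expR (- ((2 * r + M)%:R * h)) / (2 * M%:R * C)); split.
  rewrite divr_gt0 ?mulr_gt0 ?exprn_gt0 ?expR_gt0 ?ltr0n//.
  exact: lt_le_trans C1.
move=> w Gw; rewrite -nu_mu; apply: nu_ge; near=> N.
apply: (word_frequency_lower_bound hX h2 syndeticS (topological_entropy_ge0 R
  hX)) => //.
- exact: expR_gt0.
- by move=> n; exact/ltW/few_words.
- by near: N; exact: nbhs_infty_ge.
Unshelve. all: by end_near. Qed.
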